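(* Let $G$ be a graph having no isolated vertices. The following assertions are equivalent: (i) $G\neq P_3$ and $G-v$ is well-covered for every $v\in V(G)$; (ii) $G$ is $1$-well-covered; (iii) $G$ belongs to the class $\mathbf{W}_2$; (iv) for each non-maximum independent set $A$ of $G$ there are at least two disjoint independent sets $B_1,B_2$ such that $A\cup B_1, A\cup B_2\in\Omega(G)$; (v) for each non-maximum independent set $A$ of $G$ there are at least two different independent sets $B_1,B_2$ such that $A\cup B_1,A\cup B_2\in\Omega(G)$; (vi) for each pair of disjoint non-maximum independent sets $A,B$ of $G$ there exists $S\in\Omega(G)$ with $A\subseteq S$ and $B\cap S=\emptyset$; (vii) for every non-maximum independent set $A$ of $G$ and every vertex $v\notin A$ there exists $S\in\Omega(G)$ with $A\subseteq S$ and $v\notin S$.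
   Context: Graphs are finite, simple, undirected. A set of vertices is independent if no two of its vertices are adjacent; $\alpha(G)$ is the maximum size of an independent set, and $\Omega(G)$ is the family of all independent sets of size $\alpha(G)$ (maximum independent sets). A non-maximum independent set is an independent set of size less than $\alpha(G)$. A graph is well-covered if all its maximal (by inclusion) independent sets have the same cardinality. A well-covered graph with at least two vertices is $1$-well-covered if $G-v$ is well-covered for every vertex $v$ (where $G-v$ is the subgraph induced by $V(G)\setminus\{v\}$). For a positive integer $n$, a graph $G$ belongs to the class $\mathbf{W}_n$ if every $n$ pairwise disjoint independent sets of $G$ are included, respectively, in $n$ pairwise disjoint maximum independent sets of $G$. $P_3$ is the path on three vertices.
   Formalization: In (v) the sets B_1, B_2 are required to be disjoint from A (otherwise P_4 satisfies (v) but is not 1-well-covered), and G is assumed to have at least one vertex (the null graph satisfies (i) but not (ii)). *)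

(* Defs.v *)
From mathcomp Require Import all_boot.

Set Implicit Arguments.
Unset Strict Implicit.
Unset Printing Implicit Defensive.

Record sgraph := SGraph {
  vertex :> finType;
  adj : rel vertex;
  adj_sym : symmetric adj;
  adj_irr : irreflexive adj
}.

Definition no_isolated (G : sgraph) : Prop :=
  forall v : G, exists u : G, adj v u.

Section Induced.
Variables (G : sgraph) (A : {set G}).

Definition induced_adj : rel {x : G | x \in A} :=
  [rel x y | adj (val x) (val y)].

Lemma induced_sym : symmetric induced_adj.
Proof. by move=> x y; apply: adj_sym. Qed.

Lemma induced_irr : irreflexive induced_adj.
Proof. by move=> x; apply: adj_irr. Qed.

Definition induced : sgraph := SGraph induced_sym induced_irr.
End Induced.

Definition del_vertex (G : sgraph) (v : G) : sgraph := induced [set~ v].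

Definition isomorphic (G H : sgraph) : Prop :=
  exists2 f : G -> H, bijective f & forall x y : G, adj (f x) (f y) = adj x y.

Definition P3_adj : rel 'I_3 := fun i j => (i.+1 == j) || (j.+1 == i).

Lemma P3_sym : symmetric P3_adj.
Proof. by move=> i j; apply: orbC. Qed.

Lemma P3_irr : irreflexive P3_adj.
Proof. by move=> i; rewrite /P3_adj orbb gtn_eqF. Qed.

Definition P3 : sgraph := SGraph P3_sym P3_irr.

Definition independent (G : sgraph) (A : {set G}) : bool :=
  [forall x in A, forall y in A, ~~ adj x y].

Definition alpha (G : sgraph) : nat := \max_(A : {set G} | independent A) #|A|.

Definition Omega (G : sgraph) : {set {set G}} :=
  [set A : {set G} | independent A & #|A| == alpha G].

Definition nonmax_independent (G : sgraph) (A : {set G}) : Prop :=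
  independent A /\ #|A| < alpha G.

Definition well_covered (G : sgraph) : Prop :=
  forall A B : {set G},
    maxset (@independent G) A -> maxset (@independent G) B -> #|A| = #|B|.

Definition one_well_covered (G : sgraph) : Prop :=
  [/\ 2 <= #|G|, well_covered G & forall v : G, well_covered (del_vertex v)].

(* W n G is meant for n > 0. *)
Definition W (n : nat) (G : sgraph) : Prop :=
  forall A : 'I_n -> {set G},
    (forall i, independent (A i)) ->
    (forall i j, i != j -> [disjoint A i & A j]) ->
    exists S : 'I_n -> {set G},
      [/\ forall i, S i \in Omega G,
          forall i j, i != j -> [disjoint S i & S j]
        & forall i, A i \subset S i].

(* Main.v *)
(* All the conditions are compared with the statement that every independent
   set [A] and vertex [v] outside [A] admit a maximum independent set containing
   [A] and avoiding [v].  Single vertices can be exchanged one at a time, so one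
   can then avoid any independent set disjoint from [A]; applying this twice
   gives W_2.  For (i) => (ii), two maximal independent sets of different sizes
   must partition the vertices, and an extremal argument leaves only P_3. *)

Require Import Defs.
From mathcomp Require Import all_boot.

Set Implicit Arguments.
Unset Strict Implicit.
Unset Printing Implicit Defensive.

(** * Independent, maximal independent and maximum independent sets *)

Section IndependentSets.
Variable G : sgraph.
Implicit Types (A B S T : {set G}) (u v w : G).

Lemma independentP A :
  reflect (forall x y, x \in A -> y \in A -> ~~ adj x y) (independent A).
Proof.
apply: (iffP forall_inP) => [h x y xA yA | h x xA].
  by move/forall_inP: (h x xA); apply.
by apply/forall_inP => y; apply: h.
Qed.

Lemma independentS A B : A \subset B -> independent B -> independent A.
Proof.
move=> /subsetP sAB /independentP iB; apply/independentP => x y /sAB xB /sAB.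
exact: iB.
Qed.

Lemma independent0 : independent (set0 : {set G}).
Proof. by apply/independentP => x y; rewrite inE. Qed.

Lemma independent1 v : independent [set v].
Proof. by apply/independentP => x y /set1P-> /set1P->; rewrite adj_irr. Qed.

Lemma independentU1 A v :
  independent A -> (forall x, x \in A -> ~~ adj v x) -> independent (v |: A).
Proof.
move=> /independentP iA h; apply/independentP => x y.
case/setU1P=> [->|xA] /setU1P[->|yA]; rewrite ?adj_irr ?h //; last exact: iA.
by rewrite adj_sym h.
Qed.

Lemma leq_alpha A : independent A -> #|A| <= alpha G.
Proof. by move=> iA; rewrite /alpha (bigmax_sup A). Qed.

Lemma OmegaP S : reflect (independent S /\ #|S| = alpha G) (S \in Omega G).
Proof. by rewrite inE; apply: (iffP andP) => -[? /eqP]. Qed.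

Lemma Omega_neq0 : exists S, S \in Omega G.
Proof.
have [|S iS eS] := @eq_bigmax_cond _ (@independent G) (fun A => #|A|).
  by apply/card_gt0P; exists set0; exact: independent0.
by exists S; apply/OmegaP; split; rewrite // /alpha eS.
Qed.

Lemma Omega_maxset S : S \in Omega G -> maxset (@independent G) S.
Proof.
case/OmegaP=> iS cS; apply/maxsetP; split=> // B iB sSB.
by apply/esym/eqP; rewrite eqEcard sSB cS leq_alpha.
Qed.

Lemma maxset_neighbor A v :
  maxset (@independent G) A -> v \notin A -> exists2 x, x \in A & adj v x.
Proof.
case/maxsetP=> iA mA vA; apply/exists_inP; apply: contraNT vA => h.
rewrite -(mA (v |: A)) ?setU11 ?subsetUr //; apply: independentU1 => // x xA.
by apply: contraNN h => e; apply/exists_inP; exists x.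
Qed.

(** * Independent sets of [G - v], handled as sets of vertices of [G] *)

Definition indep_off v A := independent A && (v \notin A).

Lemma maxset_indep_off v A :
  maxset (@independent G) A -> v \notin A -> maxset (indep_off v) A.
Proof.
case/maxsetP=> iA mA vA; apply/maxsetP; split; first exact/andP.
by move=> B /andP[iB _]; apply: mA.
Qed.

Lemma exists_maxset_indep_off v A :
  independent A -> v \notin A -> exists2 S, maxset (indep_off v) S & A \subset S.
Proof.
move=> iA vA; have [|S] := @maxset_exists _ (indep_off v) A; first exact/andP.
by exists S.
Qed.

Definition del_set v A : {set del_vertex v} := [set x | val x \in A].

Lemma val_del_set v A : v \notin A -> val @: del_set v A = A.
Proof.
move=> vA; apply/setP => x; apply/imsetP/idP => [[y + ->]|xA]; first by rewrite inE.
have xv : x \in [set~ v] by rewrite !inE; apply: contraNneq vA => <-.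
by exists (Sub x xv); rewrite ?inE /= ?SubK.
Qed.

Lemma indep_off_val v (X : {set del_vertex v}) :
  indep_off v (val @: X) = independent X.
Proof.
rewrite /indep_off [v \in _](_ : _ = false) ?andbT; last first.
  by apply/negP => /imsetP[y _ e]; move: (valP y); rewrite -e !inE eqxx.
apply/independentP/idP => [h|/forall_inP h x y /imsetP[x' x'X ->] /imsetP[y' y'X ->]].
  apply/forall_inP => x xX; apply/forall_inP => y yX.
  exact: (h _ _ (imset_f _ xX) (imset_f _ yX)).
by move/forall_inP: (h _ x'X) => /(_ _ y'X).
Qed.

Lemma maxset_val v (X : {set del_vertex v}) :
  maxset (@independent (del_vertex v)) X = maxset (indep_off v) (val @: X).
Proof.
apply/maxsetP/maxsetP => -[iX mX]; split; rewrite ?indep_off_val //.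
- move=> B iB sXB; have vB : v \notin B by case/andP: iB.
  rewrite -(val_del_set vB) in iB *; rewrite indep_off_val in iB.
  rewrite (mX _ iB) //; apply/subsetP => x xX; rewrite inE.
  by apply: (subsetP sXB); apply: imset_f.
- by rewrite -indep_off_val.
- move=> Y iY sXY; apply: (imset_inj val_inj); apply: mX; rewrite ?indep_off_val //.
  exact: imsetS.
Qed.

Lemma well_covered_del v :
  well_covered (del_vertex v) <->
  (forall A B, maxset (indep_off v) A -> maxset (indep_off v) B -> #|A| = #|B|).
Proof.
split=> [h A B mA mB | h X Y]; last first.
  rewrite !maxset_val => mX mY.
  by rewrite -(card_imset X val_inj) -(card_imset Y val_inj); apply: h.
have /andP[_ vA] : indep_off v A by case/maxsetP: mA.
have /andP[_ vB] : indep_off v B by case/maxsetP: mB.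
rewrite -(val_del_set vA) -(val_del_set vB) in mA mB *.
by rewrite !card_imset; try exact: val_inj; apply: h; rewrite maxset_val.
Qed.

(** * Avoiding a vertex or an independent set, and the class W_2 *)

Definition avoidable :=
  forall A v, independent A -> v \notin A ->
  exists S, [/\ S \in Omega G, A \subset S & v \notin S].

(* Exchange argument: if [S] minimises [#|S :&: B|] and [v] is in [S :&: B],
   completing [S :\ v] while avoiding [v] adds a neighbour of [v], which is
   not in [B]. *)
Lemma avoidable_separation : avoidable ->
  forall A B, independent A -> independent B -> [disjoint A & B] ->
  exists S, [/\ S \in Omega G, A \subset S & [disjoint S & B]].
Proof.
move=> avG A B iA iB dAB.
have [S0 [mS0 sAS0]] : exists S, S \in Omega G /\ A \subset S.
  (* If [A] contains every vertex, a maximum independent set lies in [A] and has at least its size,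
     so equals it. *)
  have [v vA|h] := pickP [predC A].
    by have [S [SO sAS _]] := avG A v iA vA; exists S.
  have [S SO] := Omega_neq0; exists S; split=> //; case/OmegaP: SO => iS cS.
  have sSA : S \subset A by apply/subsetP => x _; have /negbFE := h x.
  by rewrite (_ : S = A) //; apply/eqP; rewrite eqEcard sSA cS leq_alpha.
pose P := [pred S | (S \in Omega G) && (A \subset S)].
have P0 : P S0 by rewrite /= mS0.
case: (arg_minnP (fun S => #|S :&: B|) P0) => S /andP[SO sAS] minS.
exists S; split=> //; apply/pred0P => v /=; apply/negP => /andP[vS vB].
have vA : v \notin A by move/disjointFl: dAB => ->.
case/OmegaP: (SO) => iS cS.
have [|T [TO sST vT]] := avG (S :\ v) v (independentS (subD1set _ _) iS).
  by rewrite setD11.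
have sAT : A \subset T.
  apply: subset_trans sST; apply/subsetP => x xA; rewrite !inE (subsetP sAS) // andbT.
  by apply: contraNneq vA => <-.
have {minS} := minS T; rewrite inE TO sAT => /(_ isT); apply/negP; rewrite -ltnNge.
apply: proper_card; apply/properP; split; last first.
  by exists v; rewrite !inE ?vS ?vB ?(negbTE vT).
case/OmegaP: (TO) => iT cT.
have [w wT vw] := maxset_neighbor (Omega_maxset TO) vT.
have wS : w \notin S.
  by apply/negP => wS; move/independentP: iS => /(_ _ _ vS wS); rewrite vw.
(* [T] has the size of [S], so exactly one vertex, [w], replaces [v]. *)
have eT : w |: (S :\ v) = T.
  apply/eqP; rewrite eqEcard subUset sub1set wT sST cT -cS.
  by rewrite (cardsD1 v S) vS cardsU1 !inE (negbTE wS) andbF /= leqnn.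
apply/subsetP => x; rewrite !inE -eT => /andP[] + xB; rewrite xB andbT.
case/setU1P=> [xw|]; last by case/setD1P.
by move/independentP: iB => /(_ _ _ vB xB); rewrite xw vw.
Qed.

(** The set [S] found around [A ord0] is itself independent and misses [A ord_max], so it can serve
    as the set to avoid in a second separation. *)
Lemma avoidable_W2 : avoidable -> W 2 G.
Proof.
move=> avG A iA dA; have d01 : [disjoint A ord0 & A ord_max] by apply: dA.
have [S [SO sAS dS]] := avoidable_separation avG (iA _) (iA _) d01.
have iS : independent S by case/OmegaP: SO.
rewrite disjoint_sym in dS.
have [T [TO sAT dT]] := avoidable_separation avG (iA ord_max) iS dS.
have ordE (i : 'I_2) : i = if i == ord0 then ord0 else ord_max.
  by apply/val_inj; case: i => [[|[|[]]]].
exists (fun i => if i == ord0 then S else T); split=> [i|i j|i].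
- by case: ifP.
- rewrite (ordE i) (ordE j); case: (i == _); case: (j == _) => //= _.
  by rewrite disjoint_sym.
- by rewrite (ordE i); case: (i == _).
Qed.

Lemma W2_disjoint_extensions : W 2 G ->
  forall A B, independent A -> independent B -> [disjoint A & B] ->
  exists S T, [/\ S \in Omega G, T \in Omega G, [disjoint S & T], A \subset S
                & B \subset T].
Proof.
move=> W2G A B iA iB dAB.
have [i|i j|S [SO dS sS]] := W2G (fun i => if i == ord0 then A else B).
- by case: ifP.
- case: i j => [[|[|//]] ?] [[|[|//]] ?] //= _.
  by rewrite disjoint_sym.
exists (S ord0), (S ord_max); split=> //; first exact: dS.
  exact: (sS ord0).
exact: (sS ord_max).
Qed.

Lemma well_covered_maxset_Omega A :
  well_covered G -> maxset (@independent G) A -> A \in Omega G.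
Proof.
move=> wcG mA; have [S SO] := Omega_neq0.
apply/OmegaP; split; first by case/maxsetP: mA.
by rewrite (wcG _ _ mA (Omega_maxset SO)); case/OmegaP: SO.
Qed.

(** A maximal independent set [T] of [G] through a neighbour of [v] misses [v], so it is maximal in
    [G - v] too. Hence a maximal extension of [A] in [G - v] has the size of [T], which is
    [alpha G]. *)
Lemma one_well_covered_avoidable :
  no_isolated G -> one_well_covered G -> avoidable.
Proof.
move=> niG [_ wcG wcD] A v iA vA.
have [S mS sAS] := exists_maxset_indep_off iA vA.
have /andP[iS vS] : indep_off v S by case/maxsetP: mS.
exists S; split=> //; apply/OmegaP; split=> //.
have [u vu] := niG v; have [T mT] := maxset_exists (independent1 u).
rewrite sub1set => uT.
have vT : v \notin T.
  apply/negP => vT; have /independentP iT : independent T by case/maxsetP: mT.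
  by have := iT _ _ vT uT; rewrite vu.
rewrite ((well_covered_del v).1 (wcD v) _ _ mS (maxset_indep_off mT vT)).
by case/OmegaP: (well_covered_maxset_Omega wcG mT).
Qed.

Lemma nonmax_or_Omega A :
  independent A -> nonmax_independent A \/ A \in Omega G.
Proof.
move=> iA; have := leq_alpha iA; rewrite leq_eqVlt => /orP[/eqP e|lt].
  by right; apply/OmegaP.
by left.
Qed.

(* A set maximal among the independent sets avoiding [v], if not maximum, has
   at most one completion, namely by [v] itself. *)
Lemma two_extensions_avoidable :
  (forall A, nonmax_independent A ->
     exists B1 B2, [/\ independent B1 /\ independent B2,
       [disjoint A & B1] /\ [disjoint A & B2], B1 <> B2,
       A :|: B1 \in Omega G & A :|: B2 \in Omega G]) ->
  avoidable.
Proof.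
move=> ext A v iA vA; have [S mS sAS] := exists_maxset_indep_off iA vA.
have /andP[iS vS] : indep_off v S by case/maxsetP: mS.
exists S; split=> //; case: (nonmax_or_Omega iS) => // nS.
have [B1 [B2 [_ [d1 d2] neB O1 O2]]] := ext S nS.
have only_v B : [disjoint S & B] -> S :|: B \in Omega G -> B = [set v].
  move=> dB /OmegaP[iSB cSB]; apply/eqP; rewrite eqEsubset; apply/andP.
  have sB : B \subset [set v].
    apply/subsetP => w wB; rewrite inE; apply: contraT => wv.
    have wS : w \notin S by rewrite (disjointFl dB wB).
    case/maxsetP: mS => _ /(_ (w |: S)) h; move: wS; rewrite -h ?setU11 ?subsetUr //.
    rewrite /indep_off in_setU1 negb_or eq_sym wv vS !andbT.
    by apply: independentS iSB; rewrite subUset sub1set inE wB orbT subsetUl.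
  split=> //; rewrite sub1set; apply: contraT => vB.
  (* Without [v], [B] would be empty and [S] already maximum. *)
  have B0 : B = set0.
    apply/setP => x; rewrite inE; apply/negP => xB.
    by move: (subsetP sB _ xB) vB; rewrite inE => /eqP<-; rewrite xB.
  by case: nS => _; rewrite -cSB B0 setU0 ltnn.
by case: neB; rewrite (only_v B1) // (only_v B2).
Qed.

(** * Maximal independent sets of unequal sizes, and P_3 *)

Lemma disjoint_unbalanced_maxsets A B :
  no_isolated G -> (forall v, well_covered (del_vertex v)) ->
  maxset (@independent G) A -> maxset (@independent G) B -> #|A| <> #|B| ->
  A :|: B = setT /\ [disjoint A & B].
Proof.
move=> niG wcD mA mB neAB.
(* A vertex [v] outside both would leave both maximal in [G - v], hence of equal size. *)
have cov v : v \in A :|: B.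
  apply: contraT; rewrite inE negb_or => /andP[vA vB]; case: neAB.
  by apply: ((well_covered_del v).1 (wcD v)); apply: maxset_indep_off.
split; first by apply/setP => v; rewrite cov inE.
(* A neighbour of a common vertex lies in [A] or in [B], against independence. *)
apply/pred0P => v /=; apply/negP => /andP[vA vB]; have [u vu] := niG v.
case/maxsetP: mA mB => /independentP iA _ /maxsetP[/independentP iB _].
have := cov u; rewrite inE => /orP[uA|uB].
  by have := iA _ _ vA uA; rewrite vu.
by have := iB _ _ vB uB; rewrite vu.
Qed.

Lemma isomorphic_P3 (a b c : G) :
  b != a -> c != a -> b != c -> (forall x, [|| x == a, x == b | x == c]) ->
  adj a b -> adj a c -> ~~ adj b c -> isomorphic G P3.
Proof.
move=> ba ca bc cov ab ac /negbTE nbc.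
pose o (k : nat) (lt : k < 3) : P3 := Ordinal lt.
(* Edges of [P3] join consecutive indices, so the centre [a] takes index 1; the inverse reads the
   list [[:: b; a; c]]. *)
pose f x : P3 := if x == a then o 1 isT else if x == b then o 0 isT else o 2 isT.
exists f.
  exists (fun i : P3 => nth a [:: b; a; c] i) => [x|[[|[|[|//]]] ?]].
  - by rewrite /f; have := cov x; case: eqP => //= _; case: eqP => //= _ /eqP.
  - by apply/val_inj; rewrite /= /f (negbTE ba) eqxx.
  - by apply/val_inj; rewrite /= /f eqxx.
  - by apply/val_inj; rewrite /= /f (negbTE ca) eq_sym (negbTE bc).
have fa : f a = o 1 isT by rewrite /f eqxx.
have fb : f b = o 0 isT by rewrite /f (negbTE ba) eqxx.
have fc : f c = o 2 isT by rewrite /f (negbTE ca) eq_sym (negbTE bc).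
move=> x y; case/or3P: (cov x) => /eqP->; case/or3P: (cov y) => /eqP->;
  rewrite ?fa ?fb ?fc ?adj_irr //= ?ab ?ac ?nbc //.
- by rewrite adj_sym ab.
- by rewrite adj_sym ac.
- by rewrite adj_sym nbc.
Qed.

(* For maximal independent sets [A], [B] with [#|A| < #|B|] and [a] in [A], a
   set [C] maximal off [a] with [A :\ a \subset C] has size [#|B|]; it is again
   disjoint from [A], so that [A] is [[set a]]. *)
Lemma well_covered_of_del :
  no_isolated G -> ~ isomorphic G P3 ->
  (forall v, well_covered (del_vertex v)) -> well_covered G.
Proof.
move=> niG nP3 wcD A B mA mB; apply/eqP; apply: contraT => neAB.
wlog ltAB : A B mA mB neAB / #|A| < #|B|.
  move=> hw; case: (ltngtP #|A| #|B|) neAB => // lt _.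
    by apply: (hw A B); rewrite ?neq_ltn ?lt.
  by apply: (hw B A); rewrite ?neq_ltn ?lt.
have [covAB dAB] := disjoint_unbalanced_maxsets niG wcD mA mB (elimN eqP neAB).
have [iA maxA] := maxsetP mA; have [iB maxB] := maxsetP mB.
have wcE v X Y := (well_covered_del v).1 (wcD v) X Y.
case: nP3; have [A0|[a aA]] := set_0Vmem A.
  by move: ltAB; rewrite (maxA B iB) ?ltnn // A0 sub0set.
have aB : a \notin B by rewrite (disjointFr dAB aA).
have [|C mC sAC] := @exists_maxset_indep_off a (A :\ a) (independentS (subD1set _ _) iA).
  by rewrite setD11.
have /andP[iC aC] : indep_off a C by case/maxsetP: mC.
have cC : #|C| = #|B| by apply: wcE mC _; apply: maxset_indep_off.
(* An independent set containing [C] and [a] contains [A], hence equals [A], which is smaller than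
   [C]. *)
have mC' : maxset (@independent G) C.
  apply/maxsetP; split=> // D iD sCD; have [aD|aD] := boolP (a \in D).
    have sAD : A \subset D.
      by rewrite -(setD1K aA) subUset sub1set aD (subset_trans sAC sCD).
    have := subset_leq_card sCD; rewrite (maxA D iD sAD) cC => le.
    by rewrite ltnNge le in ltAB.
  by case/maxsetP: mC => _; apply=> //; apply/andP.
have [_ dAC] : A :|: C = setT /\ [disjoint A & C].
  by apply: disjoint_unbalanced_maxsets => //; rewrite cC; apply/eqP.
have A1 : A = [set a].
  apply/setP => x; rewrite inE; apply/idP/eqP => [xA|-> //].
  apply/eqP; apply: contraT => xa; rewrite -(disjointFr dAC xA).
  by apply: (subsetP sAC); rewrite !inE xa.
rewrite A1 cards1 in ltAB.
have [b bB] : exists b, b \in B by apply/card_gt0P; apply: ltnW.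
(* The same deletion for [b] in [B]: now [D] has the size of [A], namely 1, so [B] has at most two
   elements. *)
have [|D mD sBD] := @exists_maxset_indep_off b (B :\ b) (independentS (subD1set _ _) iB).
  by rewrite setD11.
have cD : #|D| = 1.
  rewrite -(cards1 a) -A1; apply: wcE mD _; apply: maxset_indep_off => //.
  by rewrite (disjointFl dAB bB).
have /eqP/cards2P[x [y [xy eB]]] : #|B| = 2.
  apply/eqP; rewrite eqn_leq ltAB andbT (cardsD1 b) bB add1n ltnS -cD.
  exact: subset_leq_card.
have nbr z : z \in B -> adj a z.
  move=> zB; have [|w] := maxset_neighbor mA (v := z).
    by rewrite (disjointFl dAB zB).
  by rewrite A1 inE adj_sym => /eqP->.
have xB : x \in B by rewrite eB set21.
have yB : y \in B by rewrite eB set22.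
apply: (@isomorphic_P3 a x y) => //; last 1 first.
- by move/independentP: iB; apply.
- by apply: contraNneq aB => <-.
- by apply: contraNneq aB => <-.
- by move=> z; have := in_setT z; rewrite -covAB A1 eB !inE.
- exact: nbr.
- exact: nbr.
Qed.

(** * Condition (vii) implies condition (i) *)

Definition nonmax_avoidable :=
  forall A v, nonmax_independent A -> v \notin A ->
  exists S, [/\ S \in Omega G, A \subset S & v \notin S].

(** By (vii), a non-maximum independent set avoiding [v] can still be enlarged while avoiding [v],
    so all maximal ones have size [alpha G]. *)
Lemma nonmax_avoidable_well_covered_del :
  nonmax_avoidable -> forall v, well_covered (del_vertex v).
Proof.
move=> avG v; apply/well_covered_del.
suff card_alpha A : maxset (indep_off v) A -> #|A| = alpha G.
  by move=> A B mA mB; rewrite !card_alpha.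
case/maxsetP=> /andP[iA vA] maxA.
case: (nonmax_or_Omega iA) => [nA|/OmegaP[] //].
have [S [/OmegaP[iS <-] sAS vS]] := avG A v nA vA.
by rewrite (maxA S) //; apply/andP.
Qed.

(** The centre of P_3 alone is non-maximum, since the two ends are independent, yet both ends are
    adjacent to it, so no maximum independent set contains it. *)
Lemma nonmax_avoidable_not_P3 : nonmax_avoidable -> ~ isomorphic G P3.
Proof.
move=> avG [f [g fK gK] f_adj].
pose o (k : nat) (lt : k < 3) : P3 := Ordinal lt.
pose a := g (o 1 isT); pose b := g (o 0 isT); pose c := g (o 2 isT).
have g_adj i j : adj (g i) (g j) = adj i j by rewrite -f_adj !gK.
have bc : b != c by rewrite (can_eq gK).
have ba : b != a by rewrite (can_eq gK).
have le2 : 2 <= alpha G.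
  have <- : #|[set b; c]| = 2 by rewrite cards2 bc.
  apply: leq_alpha; apply: independentU1 (independent1 c) _ => x /set1P->.
  by rewrite g_adj.
have [||S [/OmegaP[iS cS] aS bS]] := avG [set a] b.
- by split; [exact: independent1 | rewrite cards1].
- by rewrite inE.
move: le2; rewrite -cS (cardsD1 a) -sub1set aS add1n ltnS => /card_gt0P[x].
rewrite !inE => /andP[xa xS]; rewrite sub1set in aS.
have := independentP _ iS _ _ aS xS; move: xa; rewrite -(fK x) g_adj (can_eq gK).
by case: (f x) => [[|[|[|]]]].
Qed.

End IndependentSets.

(** * The cycle of implications between the seven conditions *)

Theorem theorem2p2 (G : sgraph) (G_nonempty : 0 < #|G|)
    (G_no_isolated : no_isolated G) :
  [<-> ~ isomorphic G P3 /\ (forall v : G, well_covered (del_vertex v));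
       one_well_covered G;
       W 2 G;
       forall A : {set G}, nonmax_independent A ->
         exists B1 B2 : {set G},
           [/\ independent B1, independent B2, [disjoint B1 & B2],
               A :|: B1 \in Omega G & A :|: B2 \in Omega G];
       forall A : {set G}, nonmax_independent A ->
         exists B1 B2 : {set G},
           [/\ independent B1 /\ independent B2,
               [disjoint A & B1] /\ [disjoint A & B2], B1 <> B2,
               A :|: B1 \in Omega G & A :|: B2 \in Omega G];
       forall A B : {set G}, nonmax_independent A -> nonmax_independent B ->
         [disjoint A & B] ->
         exists S : {set G}, [/\ S \in Omega G, A \subset S & B :&: S = set0];
       forall (A : {set G}) (v : G), nonmax_independent A -> v \notin A ->
         exists S : {set G}, [/\ S \in Omega G, A \subset S & v \notin S]].
Proof.
tfae.
- move=> [nP3 wcD]; split=> //; last exact: well_covered_of_del.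
  case/card_gt0P: G_nonempty => v _; have [u vu] := G_no_isolated v.
  have <- : #|[set v; u]| = 2.
    by rewrite cards2; case: eqP vu => // ->; rewrite adj_irr.
  exact: max_card.
- by move=> wcG; apply: avoidable_W2; apply: one_well_covered_avoidable.
- move=> W2G A [iA _].
  have extD (S : {set G}) : A \subset S -> S \in Omega G ->
      independent (S :\: A) /\ A :|: (S :\: A) = S.
    move=> sAS /OmegaP[iS _]; split; first exact: independentS (subsetDl _ _) iS.
    by rewrite setDE setUIr setUCr setIT; apply/setUidPr.
  (* W_2 is used twice: on [A] and the empty set to get [S], then on [A] and [S :\: A] to get [T]
     containing [A] and disjoint from [S :\: A]. *)
  have [|S [_ [SO _ _ sAS _]]] := W2_disjoint_extensions W2G iA (independent0 G).
    by rewrite -setI_eq0 setI0.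
  have [iSA eSA] := extD S sAS SO.
  have [|T [U [TO _ dTU sAT sU]]] := W2_disjoint_extensions W2G iA iSA.
    by rewrite -setI_eq0 setIDA setDIl setDv set0I.
  have [iTA eTA] := extD T sAT TO.
  exists (S :\: A), (T :\: A); rewrite eSA eTA; split=> //.
  rewrite disjoint_sym; apply: disjointWl (subsetDl T A) _.
  exact: disjointWr sU dTU.
- move=> ext A nA; have [B1 [B2 [i1 i2 d12 O1 O2]]] := ext A nA.
  have unD (B : {set G}) : A :|: (B :\: A) = A :|: B.
    by apply/setP => x; rewrite !inE; case: (x \in A).
  (* The sets given by (iv) may meet [A], so [A] is removed from them. *)
  exists (B1 :\: A), (B2 :\: A); rewrite !unD; split=> //.
  + by split; apply: independentS (subsetDl _ _) _.
  + by split; rewrite -setI_eq0 setIDA setDIl setDv set0I.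
  (* If the remainders coincide, disjointness makes them empty, so [A] is already maximum. *)
  move=> e; case: nA => _; case/OmegaP: O1 => _ <-.
  rewrite ltnNge subset_leq_card //; apply/subsetP => x; rewrite inE => /orP[//|x1].
  apply: contraT => xA; have : x \in B1 :\: A by rewrite inE xA.
  by rewrite e inE xA (disjointFr d12 x1).
- move=> ext A B [iA _] [iB _] dAB.
  have [S [SO sAS dS]] := avoidable_separation (two_extensions_avoidable ext) iA iB dAB.
  by exists S; split=> //; apply/eqP; rewrite setI_eq0 disjoint_sym.
(* Taking [B] to be [[set v]] requires [[set v]] to be non-maximum. If [alpha G] is at most 1, then
   [A] is empty and a neighbour of [v] alone is a maximum set. *)
- move=> sep A v nA vA; have [a1|a1] := ltnP 1 (alpha G).
    have [||S [SO sAS /setP/(_ v)]] := sep A [set v] nA.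
    + by split; [exact: independent1 | rewrite cards1].
    + by rewrite disjoint_sym disjoints1.
    by rewrite !inE eqxx /= => /negbT vS; exists S.
  have [u vu] := G_no_isolated v; exists [set u]; split.
  + apply/OmegaP; split; first exact: independent1.
    by apply/eqP; rewrite eqn_leq leq_alpha ?independent1 // cards1.
  + case: nA => _ lt; have := leq_trans lt a1; rewrite ltnS leqn0 cards_eq0.
    by move/eqP->; rewrite sub0set.
  + by rewrite inE; case: eqP vu => // ->; rewrite adj_irr.
- move=> avG; split; first exact: nonmax_avoidable_not_P3.
  exact: nonmax_avoidable_well_covered_del.
Qed.
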